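(* Let $n\ge3$ be prime and let $m$ be a positive integer with $\gcd(m,n)=1$. Let $L_n$ be the $n\times n$ matrix indexed by $0,\ldots,n-1$ with $(0,0)$ entry $3$, $(i,i)$ entry $2$ for $1\le i\le n-1$, entry $-1$ in positions $(i,j)$ with $j\equiv i\pm1\pmod n$, and $0$ elsewhere (the Laplacian of the leafed $n$-cycle minored at its leaf), and let $\mathcal{C}_n=\{\lambda\in\mathbb{R}^n:L_n\lambda\ge0\}$. Then the number of integer points $\lambda=(\lambda_0,\ldots,\lambda_{n-1})\in\mathcal{C}_n\cap\mathbb{Z}^n$ with $\lambda_0=m$ equals the number of compositions of $m$ into $n$ parts up to cyclic shift, i.e. the number of orbits of the set $\{(c_0,\ldots,c_{n-1})\in\mathbb{Z}_{\ge0}^n:\sum c_i=m\}$ under the cyclic rotation $(c_0,\ldots,c_{n-1})\mapsto(c_1,\ldots,c_{n-1},c_0)$.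
   Context: Compositions here are weak compositions (parts may be $0$). The leafed $n$-cycle is the $n$-cycle on $0,\ldots,n-1$ with an extra vertex $n$ adjacent only to $0$. *)

(* Defs.v *)
From HB Require Import structures.
From mathcomp Require Import all_boot all_order all_algebra.
From mathcomp Require Import mathcomp_extra boolp classical_sets functions.
From mathcomp Require Import cardinality reals.

Set Implicit Arguments.
Unset Strict Implicit.
Unset Printing Implicit Defensive.

Import Order.TTheory GRing.Theory Num.Theory.

Local Open Scope classical_set_scope.
Local Open Scope ring_scope.

(* [j.+1 == i %[mod n]] says j = i - 1 mod n. *)
Definition leafed_cycle_mx (R : pzRingType) (n : nat) : 'M[R]_n :=
  \matrix_(i < n, j < n)
    if i == j then (if i == 0%N :> nat then 3%:R else 2%:R)
    else if (j == i.+1 %[mod n])%N || (j.+1 == i %[mod n])%N then -1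
    else 0.

Definition leafed_cycle_cone (R : realType) (n : nat) : set 'cV[R]_n :=
  [set lam | forall i, 0 <= (leafed_cycle_mx R n *m lam) i ord0].

Definition integer_points (R : realType) (n : nat) : set 'cV[R]_n :=
  [set lam | forall i, lam i ord0 \is a Num.int].

Arguments leafed_cycle_cone : clear implicits.
Arguments integer_points : clear implicits.

(* Each part of a weak composition of m is at most m, so taking the parts in
   'I_m.+1 loses nothing and makes the ambient type finite. *)
Definition weak_compositions (n m : nat) : {set n.-tuple 'I_m.+1} :=
  [set c : n.-tuple 'I_m.+1 | (\sum_(i < n) tnth c i == m)%N].

(* (c_0, ..., c_(n-1)) |-> (c_1, ..., c_(n-1), c_0) *)
Definition rotation (T : Type) (n : nat) (c : n.-tuple T) : n.-tuple T :=
  [tuple of rot 1 c].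

(* [fcard f a] counts the f-orbits in a when f is injective and a is f-closed;
   both conditions are checked in [rotation_inj], [fclosed_rotation] below. *)
Definition num_cyclic_compositions (n m : nat) : nat :=
  fcard (@rotation 'I_m.+1 n) (weak_compositions n m).

Lemma rotation_inj (T : Type) (n : nat) : injective (@rotation T n).
Proof. by move=> c d /(congr1 val) /= /rot_inj /val_inj. Qed.

Lemma fclosed_rotation (n m : nat) :
  fclosed (@rotation 'I_m.+1 n) (weak_compositions n m).
Proof.
move=> c _ /eqP <-; rewrite !inE; congr (_ == _).
rewrite -(big_tuple _ _ c xpredT (fun x : 'I_m.+1 => x : nat)).
rewrite -(big_tuple _ _ (rotation c) xpredT (fun x : 'I_m.+1 => x : nat)).
by apply/perm_big; rewrite /= perm_sym perm_rot.
Qed.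

(* Main.v *)
(* Put c = L_n lam. The columns of L_n sum to (1, 0, ..., 0) and
   sum_i i * c_i = n * (lam_(n-1) - lam_0), so an integer point of the cone with
   lam_0 = m gives a weak composition c of m with sum_i i * c_i = 0 mod n; an
   explicit inverse of L_n shows that every such composition arises, from a
   unique lam. A rotation lowers sum_i i * c_i by m mod n, so, m being prime to n,
   each rotation orbit contains exactly one such composition. *)
Require Import Defs.
From HB Require Import structures.
From mathcomp Require Import all_boot all_order all_algebra.
From mathcomp Require Import ring zify.
From mathcomp Require Import mathcomp_extra boolp classical_sets functions.
From mathcomp Require Import cardinality reals.

Set Implicit Arguments.
Unset Strict Implicit.

Import Order.TTheory GRing.Theory Num.Theory.

Local Open Scope classical_set_scope.
Local Open Scope ring_scope.

(** * Cyclic rotation and the weight modulo n *)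

Section Rotation.
Local Open Scope nat_scope.
Variables n m : nat.
Implicit Types c d : n.-tuple 'I_m.+1.

Definition weight c := \sum_(i < n) i * tnth c i.

Definition balanced_compositions : {set n.-tuple 'I_m.+1} :=
  [set c in weak_compositions n m | n %| weight c].

Lemma tnth_rotation c i : tnth (rotation c) i = tnth c (ordS i).
Proof.
rewrite !(tnth_nth ord0) /= nth_cat size_drop size_tuple nth_drop add1n.
have lt_in := ltn_ord i; rewrite ltn_subRL add1n.
case: ltnP => [/modn_small-> //|le_ni].
have -> : nat_of_ord i = n.-1 by lia.
have n_gt0 : 0 < n by lia.
by rewrite prednK // modnn subn1 subnn nth_take.
Qed.

(** After reindexing by the cyclic successor, adding m turns each coefficient i into i + 1. This
    agrees modulo n with the index of the part it multiplies, even at the wraparound. *)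
Lemma weight_rotation c :
  c \in weak_compositions n m ->
  weight (rotation c) + m = weight c %[mod n].
Proof.
rewrite inE => /eqP sum_c; rewrite /weight -[X in _ + X]sum_c.
rewrite [X in _ + X](reindex _ (onW_bij _ (ordS_bij n))) -big_split /=.
rewrite [in RHS](reindex _ (onW_bij _ (ordS_bij n))) /=.
elim/big_rec2: _ => // i x y _ eq_xy.
rewrite tnth_rotation -mulSnr -modnDmr eq_xy modnDmr.
by rewrite -modnDml -modnMml modnDml.
Qed.

Lemma iter_rotation_weak k c :
  c \in weak_compositions n m ->
  iter k (@rotation _ n) c \in weak_compositions n m.
Proof.
by move=> c_m; elim: k => //= k; rewrite -(@fclosed_rotation n m _ _ (eqxx (rotation _))).
Qed.

Lemma weight_iter_rotation k c :
  c \in weak_compositions n m ->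
  weight (iter k (@rotation _ n) c) + k * m = weight c %[mod n].
Proof.
move=> c_m; elim: k => [|k IHk]; first by rewrite addn0.
rewrite -{}IHk mulSn addnA -[in LHS]modnDml /=.
by rewrite weight_rotation ?iter_rotation_weak // modnDml.
Qed.

Lemma iter_rotation_dvd k c : n %| k -> iter k (@rotation _ n) c = c.
Proof.
have val_iter j : j <= n -> val (iter j (@rotation _ n) c) = rot j c.
  elim: j => [|j IHj] lt_jn; first by rewrite rot0.
  by rewrite /= IHj ?(ltnW lt_jn) // -rotS ?size_tuple.
have iter_n : iter n (@rotation _ n) c = c.
  by apply: val_inj; rewrite val_iter // -{1}(size_tuple c) rot_size.
by case/dvdnP=> q ->; rewrite iterM iter_fix.
Qed.

Lemma num_cyclic_compositionsE :
  coprime m n -> num_cyclic_compositions n m = #|balanced_compositions|.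
Proof.
move=> co_mn; set f := @rotation 'I_m.+1 n.
have symf : connect_sym (frel f) := fconnect_sym (@rotation_inj _ n).
(* If k rotations join two balanced compositions, then n divides k * m, hence k, and those k
   rotations act as the identity. *)
have f_inj : {in balanced_compositions &, injective (froot f)}.
  move=> c d; rewrite [c \in _]inE [d \in _]inE.
  move=> /andP[c_m /eqP Wc] /andP[_ /eqP Wd] /eqP.
  rewrite root_connect // => /iter_findex Ed.
  rewrite -[LHS](@iter_rotation_dvd (findex f c d)) //.
  rewrite -(@Gauss_dvdl _ _ m) 1?coprime_sym // /dvdn.
  have := weight_iter_rotation (findex f c d) c_m.
  by rewrite Ed -modnDml Wd add0n Wc => /eqP.
rewrite /num_cyclic_compositions -(card_in_imset f_inj).
apply: eq_card => r; rewrite inE; apply/andP/imsetP => [[root_r r_m]|].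
  (* Rotating k times subtracts k * m from the weight modulo n. The Chinese remainder theorem gives
     a multiple x = k * m that is congruent to [weight r]. *)
  pose x := chinese m n 0 (weight r).
  have /dvdnP[k Ek] : m %| x by rewrite /dvdn chinese_modl // mod0n.
  exists (iter k f r); last first.
    by rewrite -(fingraph.rootP symf (fconnect_iter f k r)) (eqP root_r).
  rewrite inE iter_rotation_weak //=.
  have := weight_iter_rotation k r_m.
  rewrite -Ek -(chinese_modr co_mn 0 (weight r)) -/x -{2}[x]add0n => /eqP.
  by rewrite eqn_modDr mod0n.
case=> c; rewrite inE => /andP[c_m _] ->; split; first exact: roots_root.
change (froot f c \in weak_compositions n m).
by rewrite -(closed_connect (@fclosed_rotation n m) (connect_root _ c)).
Qed.

End Rotation.

Lemma sum_delta_mul (R : pzRingType) (I : finType) (k : I) (F : I -> R) :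
  \sum_i (i == k)%:R * F i = F k.
Proof.
by rewrite (bigD1 k) //= eqxx mul1r big1 ?addr0 // => i /negPf->; rewrite mul0r.
Qed.

(** * The matrix of the leafed cycle and its explicit inverse *)

Section LeafedCycle.
Variables (n : nat).
Hypothesis n_ge3 : (3 <= n)%N.

(** The nested tests become a sum of deltas because i, i + 1 and i - 1 are pairwise distinct modulo
    n. *)
Lemma leafed_cycle_mxE (R : pzRingType) (i j : 'I_n) :
  leafed_cycle_mx R n i j =
  (2 + (i == 0%N :> nat))%:R * (j == i)%:R - (j == ordS i)%:R
    - (j == ord_pred i)%:R.
Proof.
have n_gt0 : (0 < n)%N by lia.
rewrite mxE [j == i]eq_sym; have lt_i := ltn_ord i; have lt_j := ltn_ord j.
have S_i : (j == ordS i) = (j == i.+1 %[mod n])%N.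
  by rewrite -val_eqE /= [in RHS]modn_small.
have pred_i : (j == ord_pred i) = (j.+1 == i %[mod n])%N.
  by rewrite -(inj_eq (@ordS_inj n)) ord_predK -val_eqE /= [(i %% n)%N]modn_small.
have n_S : i != ordS i.
  rewrite -val_eqE /=; have [lt|le] := ltnP i.+1 n.
    by rewrite modn_small //; lia.
  have -> : i.+1 = n :> nat by lia.
  by rewrite modnn; lia.
have n_pred : i != ord_pred i by rewrite -(inj_eq (@ordS_inj n)) ord_predK eq_sym.
(* Shifted by one, this says that 2 is nonzero modulo n, which is where 3 <= n enters. *)
have n_S_pred : ordS i != ord_pred i.
  rewrite -(inj_eq (@ordS_inj n)) ord_predK -val_eqE /= -[X in (X %% _)%N]addn1.
  rewrite modnDml addn1 -{2}[nat_of_ord i](modn_small lt_i) -addn2.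
  by rewrite -{2}[nat_of_ord i]addn0 eqn_modDl mod0n modn_small.
rewrite -S_i -pred_i; case: (eqVneq j i) => [->|_].
  rewrite (negPf n_S) (negPf n_pred) mulr1 !subr0.
  by case: (nat_of_ord i).
rewrite mulr0 sub0r; case: (eqVneq j (ordS i)) => [->|_] /=.
  by rewrite (negPf n_S_pred) subr0.
by case: (j == ord_pred i); rewrite ?oppr0 ?sub0r ?subr0 ?addr0.
Qed.

Lemma mul_leafed_cycle_mx (R : pzRingType) (lam : 'cV[R]_n) (i : 'I_n) :
  (leafed_cycle_mx R n *m lam) i ord0 =
  (2 + (i == 0%N :> nat))%:R * lam i ord0 - lam (ordS i) ord0
    - lam (ord_pred i) ord0.
Proof.
rewrite mxE (eq_bigr _ (fun j _ => congr1 ( *%R^~ _) (leafed_cycle_mxE R i j))).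
under eq_bigr do rewrite !mulrBl -mulrA.
by rewrite !big_split /= !sumrN -mulr_sumr !sum_delta_mul.
Qed.

Lemma natr_ord_pred (R : pzRingType) (i : 'I_n) :
  (ord_pred i)%:R = i%:R - 1 + (n * (i == 0%N :> nat))%:R :> R.
Proof.
have lt_i := ltn_ord i; rewrite /=; case: (nat_of_ord i) lt_i => [|k] lt_k.
  rewrite add0n muln1 sub0r modn_small; last by lia.
  by rewrite -subn1 natrB 1?addrC //; lia.
rewrite muln0 addr0 addSn /= modnDr modn_small; last by lia.
by rewrite -natr1 addrK.
Qed.

Lemma natr_ordS (R : pzRingType) (i : 'I_n) :
  (ordS i)%:R = i%:R + 1 - (n * (i == n.-1 :> nat))%:R :> R.
Proof.
have lt_i := ltn_ord i; rewrite /= natr1; case: eqP => [->|ni].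
  by rewrite prednK ?modnn ?muln1 ?subrr //; lia.
by rewrite modn_small ?muln0 ?subr0 //; lia.
Qed.

Lemma sum_ordS (R : nmodType) (F : 'I_n -> R) :
  \sum_i F (ordS i) = \sum_i F i.
Proof. by rewrite [RHS](reindex _ (onW_bij _ (ordS_bij n))). Qed.

Lemma sum_ord_pred (R : nmodType) (F : 'I_n -> R) :
  \sum_i F (ord_pred i) = \sum_i F i.
Proof. by rewrite [RHS](reindex _ (onW_bij _ (ord_pred_bij n))). Qed.

(* Reindexing both neighbour terms moves all coefficients onto lam i, that is,
   transposes the matrix. *)
Lemma weighted_sum_leafed_cycle_mx (R : comPzRingType) (a : 'I_n -> R)
    (lam : 'cV[R]_n) :
  \sum_i a i * (leafed_cycle_mx R n *m lam) i ord0 =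
  \sum_(i < n) ((2 + (i == 0%N :> nat))%:R * a i - a (ordS i) - a (ord_pred i))
    * lam i ord0.
Proof.
under eq_bigr do rewrite mul_leafed_cycle_mx !mulrBr.
under [RHS]eq_bigr do rewrite !mulrBl.
rewrite !big_split /= !sumrN [RHS]addrAC; congr (_ - _ - _).
- by apply: eq_bigr => i _; rewrite mulrCA mulrA.
- by rewrite -[RHS]sum_ordS; apply: eq_bigr => i _; rewrite ordSK.
- by rewrite -[RHS]sum_ord_pred; apply: eq_bigr => i _; rewrite ord_predK.
Qed.

Lemma sum_leafed_cycle_mx (R : comPzRingType) (lam : 'cV[R]_n)
    (n_gt0 : (0 < n)%N) :
  \sum_i (leafed_cycle_mx R n *m lam) i ord0 = lam (Ordinal n_gt0) ord0.
Proof.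
under eq_bigr do rewrite -[_ _ ord0]mul1r.
rewrite (weighted_sum_leafed_cycle_mx (fun=> 1)) (bigD1 (Ordinal n_gt0)) //=.
rewrite big1 => [|i ni]; first by ring.
have -> : (i == 0%N :> nat) = false by apply: contraNF ni.
by rewrite addn0; ring.
Qed.

(** The weight i is linear, so its second difference vanishes except at the two ends of the cycle,
    where the jump by n leaves n at n - 1 and -n at 0. The extra 1 in the corner entry meets weight
    0. *)
Lemma moment_leafed_cycle_mx (R : comPzRingType) (lam : 'cV[R]_n)
    (n_gt0 : (0 < n)%N) :
  \sum_(i < n) i%:R * (leafed_cycle_mx R n *m lam) i ord0 =
  n%:R * (lam (ord_pred (Ordinal n_gt0)) ord0 - lam (Ordinal n_gt0) ord0).
Proof.
rewrite (weighted_sum_leafed_cycle_mx (fun i : 'I_n => i%:R)).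
transitivity (\sum_(i < n) n%:R * ((i == ord_pred (Ordinal n_gt0))%:R * lam i ord0)
              - \sum_(i < n) n%:R * ((i == Ordinal n_gt0)%:R * lam i ord0)).
  rewrite -sumrB; apply: eq_bigr => i _; rewrite natr_ordS natr_ord_pred.
  have -> : (2 + (i == 0%N :> nat))%:R * i%:R = 2 * i%:R :> R.
    by case: (nat_of_ord i) => [|k]; rewrite ?mulr0 ?addn0.
  have -> : (i == n.-1 :> nat) = (i == ord_pred (Ordinal n_gt0)).
    by rewrite -val_eqE /= add0n modn_small //; lia.
  rewrite -[i == Ordinal _]val_eqE /= !natrM; ring.
by rewrite -!mulr_sumr -mulrBr !sum_delta_mul.
Qed.


(* Row i > 0 of L lam = c says that lam_(i+1) - lam_i drops by c_i at i; the
   initial difference is forced by lam_n = lam_0. *)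
Definition flux (R : fieldType) (c : 'cV[R]_n) (k : nat) : R :=
  \sum_i c i ord0 - (\sum_(i < n) i%:R * c i ord0) / n%:R
    - \sum_(j < n | (j <= k)%N) c j ord0.

(** The candidate solution of L lam = c. Its initial value is forced by the column sums of L; [flux]
    supplies the successive differences. *)
Definition potential (R : fieldType) (c : 'cV[R]_n) (i : nat) : R :=
  \sum_i c i ord0 + \sum_(k < i) flux c k.

Lemma potentialS (R : fieldType) (c : 'cV[R]_n) k :
  potential c k.+1 = potential c k + flux c k.
Proof. by rewrite /potential big_ord_recr addrA. Qed.

Lemma potential0 (R : fieldType) (c : 'cV[R]_n) :
  potential c 0 = \sum_i c i ord0.
Proof. by rewrite /potential big_ord0 addr0. Qed.

Lemma potential_periodic (R : numFieldType) (c : 'cV[R]_n) :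
  potential c n = potential c 0.
Proof.
rewrite potential0 /potential -[RHS]addr0; congr (_ + _).
have n_neq0 : n%:R != 0 :> R by rewrite pnatr_eq0; lia.
have -> : \sum_(k < n) flux c k =
    n%:R * (\sum_i c i ord0) - \sum_(i < n) i%:R * c i ord0
    - \sum_(k < n) \sum_(j < n | (j <= k)%N) c j ord0.
  rewrite sumrB sumr_const card_ord; congr (_ - _).
  by rewrite -[LHS]mulr_natl mulrBr mulrCA divff ?mulr1.
(* The coefficient of c_j is n - j - (n - j): n from the total, j from the moment, and n - j from
   the partial sums with k >= j. *)
rewrite (exchange_big_dep xpredT) //= !mulr_sumr -!sumrB big1 // => j _.
have -> : \sum_(k < n | (j <= k)%N) c j ord0 = c j ord0 *+ (n - j).
  by rewrite -sumr_const_nat big_geq_mkord.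
by rewrite -[_ *+ (n - j)]mulr_natl natrB ?(ltnW (ltn_ord j)) // -!mulrBl subrr mul0r.
Qed.

Lemma flux0 (R : fieldType) (c : 'cV[R]_n) (n_gt0 : (0 < n)%N) :
  flux c 0 = \sum_i c i ord0 - (\sum_(i < n) i%:R * c i ord0) / n%:R
    - c (Ordinal n_gt0) ord0.
Proof.
rewrite /flux; congr (_ - _).
rewrite (bigD1 (Ordinal n_gt0)) //= big1 ?addr0 // => j.
by rewrite leqn0 -val_eqE andbN.
Qed.

Lemma flux_pred_max (R : fieldType) (c : 'cV[R]_n) :
  flux c n.-1 = - ((\sum_(i < n) i%:R * c i ord0) / n%:R).
Proof.
rewrite /flux [X in _ - X](eq_bigl xpredT) => [|j]; first by ring.
by have := ltn_ord j; lia.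
Qed.

Lemma fluxB (R : fieldType) (c : 'cV[R]_n) (i : 'I_n) :
  (0 < i)%N -> flux c i.-1 - flux c i = c i ord0.
Proof.
move=> i_gt0; rewrite /flux [X in _ - (_ - X)](bigD1 i) //=.
rewrite [X in _ - (_ - (_ + X))](eq_bigl (fun j : 'I_n => j <= i.-1)%N) => [|j].
  by ring.
by rewrite -val_eqE /=; lia.
Qed.

Lemma mul_leafed_cycle_potential (R : numFieldType) (c : 'cV[R]_n) :
  leafed_cycle_mx R n *m \col_(i < n) potential c i = c.
Proof.
have n_gt0 : (0 < n)%N by lia.
apply/matrixP => i k; rewrite (ord1 k) mul_leafed_cycle_mx !mxE.
have lt_i := ltn_ord i.
(* Periodicity covers the wraparound at i = n - 1. *)
have -> : potential c (ordS i) = potential c i + flux c i.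
  rewrite -potentialS /=; have [lt|le] := ltnP i.+1 n.
    by rewrite modn_small.
  have -> : i.+1 = n :> nat by lia.
  by rewrite modnn potential_periodic.
have [i0|i_neq0] := eqVneq (nat_of_ord i) 0%N.
  have -> : i = Ordinal n_gt0 by apply: val_inj.
  rewrite /= add0n modn_small; last by lia.
  (* In row 0, the neighbour lam_(n-1) is lam_0 minus the last flux. *)
  have := potentialS c n.-1; rewrite prednK // potential_periodic.
  rewrite flux_pred_max flux0 potential0 => ->; ring.
have i_gt0 : (0 < i)%N by lia.
have pred_i : ord_pred i = i.-1 :> nat.
  by rewrite /= -subn1 -addnBAC // modnDr modn_small; lia.
rewrite pred_i -(fluxB c i_gt0) -{1 2}(prednK i_gt0) potentialS /=; ring.
Qed.

(** The columns of the inverse are the potentials of the standard basis vectors. *)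
Lemma leafed_cycle_mx_unit (R : numFieldType) : leafed_cycle_mx R n \in unitmx.
Proof.
suff /mulmx1_unit[] : leafed_cycle_mx R n *m
  (\matrix_(i, j) potential (col j 1%:M) i) = 1%:M by [].
apply/matrixP => i j; have := mul_leafed_cycle_potential (col j 1%:M : 'cV[R]_n).
move=> /(congr1 (fun c : 'cV_n => c i ord0)).
rewrite [in RHS]mxE => <-; rewrite mxE [RHS]mxE.
by apply: eq_bigr => k _; congr (_ * _); rewrite !mxE.
Qed.

End LeafedCycle.

(** * Lattice points of the cone as balanced compositions *)

Section LatticePoints.
Variables (R : realType) (n m : nat).
Hypothesis n_ge3 : (3 <= n)%N.
Implicit Type c : n.-tuple 'I_m.+1.

Definition composition_vector c : 'cV[R]_n := \col_i (tnth c i)%:R.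

Definition lattice_point c : 'cV[R]_n :=
  \col_(i < n) potential (composition_vector c) i.

Lemma mul_leafed_cycle_lattice_point c :
  leafed_cycle_mx R n *m lattice_point c = composition_vector c.
Proof. exact: mul_leafed_cycle_potential. Qed.

Lemma lattice_point_inj : injective lattice_point.
Proof.
move=> c d /(congr1 (mulmx (leafed_cycle_mx R n))).
rewrite !mul_leafed_cycle_lattice_point => eq_cd; apply: eq_from_tnth => i.
apply/val_inj/eqP; rewrite -(eqr_nat R); apply/eqP.
by move: eq_cd => /(congr1 (fun v : 'cV_n => v i ord0)); rewrite !mxE.
Qed.

Lemma sum_composition_vector c :
  \sum_i composition_vector c i ord0 = (\sum_(i < n) tnth c i)%N%:R.
Proof. by rewrite natr_sum; apply: eq_bigr => i _; rewrite mxE. Qed.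

Lemma moment_composition_vector c :
  \sum_(i < n) i%:R * composition_vector c i ord0 = (weight c)%:R.
Proof. by rewrite natr_sum; apply: eq_bigr => i _; rewrite mxE natrM. Qed.

Lemma lattice_point_integral c i :
  (n %| weight c)%N -> lattice_point c i ord0 \is a Num.int.
Proof.
case/dvdnP => q Eq; have n_neq0 : n%:R != 0 :> R by rewrite pnatr_eq0; lia.
have c_int j : composition_vector c j ord0 \is a Num.int by rewrite mxE natr_int.
rewrite mxE rpredD ?rpred_sum // => k _.
(* The only division in [flux] is that of the moment by n, and balancedness makes it exact. *)
rewrite /flux moment_composition_vector Eq natrM mulfK //.
by rewrite !rpredB ?rpred_sum ?natr_int.
Qed.

Lemma leafed_cycle_mx_integral (lam : 'cV[R]_n) i :
  integer_points R n lam ->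
  (leafed_cycle_mx R n *m lam) i ord0 \is a Num.int.
Proof.
by move=> lam_int; rewrite mul_leafed_cycle_mx // !rpredB ?rpredM ?natr_int.
Qed.

(** The entries of L lam are nonnegative integers with sum lam_0 = m, so each is at most m and fits
    in ['I_m.+1]. *)
Lemma composition_of_cone_point (lam : 'cV[R]_n) (n_gt0 : (0 < n)%N) :
  (leafed_cycle_cone R n `&` integer_points R n) lam ->
  lam (Ordinal n_gt0) ord0 = m%:R ->
  exists2 c, c \in weak_compositions n m &
    composition_vector c = leafed_cycle_mx R n *m lam.
Proof.
move=> [lam_cone lam_int] lam0; set v := leafed_cycle_mx R n *m lam.
have v_nat i : v i ord0 = (Num.truncn (v i ord0))%:R.
  by rewrite truncnK // natrEint leafed_cycle_mx_integral //=; apply: lam_cone.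
have sum_v : (\sum_i Num.truncn (v i ord0))%N = m.
  apply/eqP; rewrite -(eqr_nat R) natr_sum -lam0 -sum_leafed_cycle_mx //.
  by apply/eqP/eq_bigr => i _; rewrite -v_nat.
have le_vm i : (Num.truncn (v i ord0) < m.+1)%N.
  by rewrite ltnS -sum_v (bigD1 i) //= leq_addr.
exists [tuple Ordinal (le_vm i) | i < n].
  rewrite inE; apply/eqP; apply: etrans sum_v.
  by apply: eq_bigr => i _; rewrite tnth_mktuple.
by apply/colP => i; rewrite mxE tnth_mktuple -v_nat.
Qed.

Lemma cone_points_image (n_gt0 : (0 < n)%N) :
  [set lam : 'cV[R]_n |
    (leafed_cycle_cone R n `&` integer_points R n) lam /\
    lam (Ordinal n_gt0) ord0 = m%:R] =
  lattice_point @` [set` balanced_compositions n m].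
Proof.
apply/seteqP; split => [lam [lam_in lam0]|_ [c /= + <-]].
  have [c c_m Ec] := composition_of_cone_point lam_in lam0.
  exists c; last first.
    apply: (can_inj (mulKmx (leafed_cycle_mx_unit n_ge3 R))).
    by rewrite mul_leafed_cycle_lattice_point.
  rewrite /= inE c_m /=.
  have [_ lam_int] := lam_in.
  have /intrP[z Ez] : lam (ord_pred (Ordinal n_gt0)) ord0
      - lam (Ordinal n_gt0) ord0 \is a Num.int by rewrite rpredB.
  have := moment_leafed_cycle_mx n_ge3 lam n_gt0.
  (* The moment identity now reads weight c = n * z in R; recasting both sides as integer embeddings
     brings it down to the integers. *)
  rewrite -Ec moment_composition_vector Ez -[LHS]/((weight c)%:Z%:~R).
  rewrite -[n%:R]/(n%:Z%:~R) -intrM => /intr_inj Ew.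
  by rewrite -[(n %| _)%N]/(n%:Z %| (weight c)%:Z)%Z Ew dvdz_mulr.
rewrite inE => /andP[c_m c_bal].
split; last first.
  by rewrite mxE potential0 sum_composition_vector; move: c_m; rewrite inE => /eqP->.
split=> i; last exact: lattice_point_integral.
by rewrite mul_leafed_cycle_lattice_point mxE ler0n.
Qed.

End LatticePoints.

(** Passes from the cardinality of a finite set to equipotence of classical sets, by numbering
    [enum A]. *)
Lemma card_set_finset (T : finType) (A : {set T}) : ([set` A] #= `I_#|A|)%card.
Proof.
(* The empty case is separate because [nth] needs a default element. *)
have [x _|A0] := pickP (mem A); last first.
  rewrite (eq_card0 A0) II0; have -> : [set` A] = set0.
    by apply/seteqP; split => // y /=; have /= -> := A0 y.
  by rewrite card_eq0.
have -> : [set` A] = nth x (enum A) @` `I_#|A|.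
  apply/seteqP; split => [y /= Ay|_ [k /= ltk <-]].
    by exists (index y (enum A)); rewrite /= ?nth_index ?cardE ?index_mem ?mem_enum.
  by rewrite /= -mem_enum mem_nth // -cardE.
apply: inj_card_eq => j k; rewrite !inE /= => ltj ltk /eqP.
by rewrite nth_uniq -?cardE ?enum_uniq // => /eqP.
Qed.

Unset Implicit Arguments.
Set Strict Implicit.

Theorem theorem5p7 (R : realType) (n m : nat) (n_ge3 : (3 <= n)%N)
    (n_prime : prime n) (m_gt0 : (0 < m)%N) (co_mn : coprime m n) :
  ([set lam : 'cV[R]_n |
      (leafed_cycle_cone R n `&` integer_points R n) lam /\
      lam (Ordinal (prime_gt0 n_prime)) ord0 = m%:R]
     #= `I_(num_cyclic_compositions n m))%card.
Proof.
rewrite cone_points_image // num_cyclic_compositionsE //.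
apply: card_eq_trans (card_set_finset _).
by apply: inj_card_eq => c d _ _; apply: lattice_point_inj.
Qed.
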